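(* Let $(E,\mathscr{F})$ be an antimatroid on a finite ground set $E$, and let $P$ be the (join-distributive) lattice of its feasible sets, ordered by inclusion. The following statements are equivalent. 1. There exists a total order $\leq_E$ on $E$ with respect to which $(E,\mathscr{F},\leq_E)$ is a supersolvable antimatroid. 2. $P$ is a supersolvable lattice. 3. There exists a total order on $E$ with respect to which the natural edge-labelling of $P$ by $E$ is an $S_n$ EL-labelling.
   Context: A set system is a pair $(E,\mathscr{F})$ with $E$ a finite ground set and $\mathscr{F}\subseteq 2^E$ a collection of subsets called feasible sets. It is an antimatroid if $\emptyset\in\mathscr{F}$, every nonempty $A\in\mathscr{F}$ contains some $x$ with $A\setminus\{x\}\in\mathscr{F}$ (accessibility), and for all $A,B\in\mathscr{F}$ with $B\not\subseteq A$ there exists $x\in B\setminus A$ with $A\cup\{x\}\in\mathscr{F}$. Equivalently (given accessibility and $\emptyset\in\mathscr F$), $\mathscr{F}$ is closed under unions. The feasible sets ordered by inclusion form a lattice with join equal to union. Given a total order $\leq_E$ on $E$, $(E,\mathscr{F},\leq_E)$ is a supersolvable antimatroid if $\emptyset\in\mathscr{F}$ and for all $A,B\in\mathscr{F}$ with $B\not\subseteq A$, setting $x=\min_{\leq_E}(B\setminus A)$, one has $A\cup\{x\}\in\mathscr{F}$. A finite lattice is join-distributive if for every element $x$ and every set $Y$ of elements covering $x$ the interval $[x,\bigvee_{y\in Y}y]$ is boolean (isomorphic to the lattice of all subsets of a finite set). The lattice of feasible sets of an antimatroid is join-distributive. A finite lattice $P$ is supersolvable if it has a maximal chain $\mathfrak{m}$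 (an M-chain) such that for every maximal chain $\mathfrak{c}$ of $P$ the sublattice generated by $\mathfrak{m}\cup\mathfrak{c}$ is distributive. In the lattice $P$ of feasible sets of an antimatroid, every cover relation $X\prec Y$ satisfies $Y\setminus X=\{x\}$ for a single $x\in E$; the natural edge-labelling of $P$ by $E$ labels the edge $X\prec Y$ of the Hasse diagram by this $x$. An edge-labelling of a finite poset $P$ (with minimum and maximum) by a totally ordered set is an $S_n$ EL-labelling if: the labels along any maximal chain of $P$ form a permutation of one fixed $n$-element set of labels (which may be identified, as an ordered set, with $\{1,\dots,n\}$), and in every interval $[x,y]$ of $P$ there is exactly one maximal chain whose sequence of labels, read from bottom to top, is increasing. *)

(* Defs.v *)
From HB Require Import structures.
From mathcomp Require Import all_boot all_order.

Set Implicit Arguments.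
Unset Strict Implicit.
Unset Printing Implicit Defensive.

Import Order.TTheory.

Definition total_order (T : eqType) (le : rel T) : Prop :=
  [/\ reflexive le, antisymmetric le, transitive le & total le].

Section SetSystems.
Variable E : finType.
Implicit Types F : {set {set E}}.

Definition accessible F : Prop :=
  forall A : {set E}, A \in F -> A != set0 ->
  exists2 x, x \in A & A :\ x \in F.

Definition exchange F : Prop :=
  forall A B : {set E}, A \in F -> B \in F -> ~~ (B \subset A) ->
  exists2 x, x \in B :\: A & x |: A \in F.

Definition is_antimatroid F : Prop :=
  [/\ set0 \in F, accessible F & exchange F].

Definition is_min (le : rel E) (D : {set E}) (x : E) : Prop :=
  x \in D /\ {in D, forall y, le x y}.

Definition supersolvable_antimatroid F (le : rel E) : Prop :=
  set0 \in F /\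
  forall A B : {set E}, A \in F -> B \in F -> ~~ (B \subset A) ->
  forall x, is_min le (B :\: A) x -> x |: A \in F.

End SetSystems.

Record antimatroid (E : finType) := Antimatroid {
  feasible :> {set {set E}};
  antimatroidP : is_antimatroid feasible
}.

Record feasible_set (E : finType) (M : antimatroid E) := FeasibleSet {
  fset_val :> {set E};
  fset_valP : fset_val \in feasible M
}.

Fact feasible_display : Order.disp_t. Proof. exact: Order.Disp tt tt. Qed.

Section FeasibleLattice.
Variables (E : finType) (M : antimatroid E).
Local Notation P := (feasible_set M).

HB.instance Definition _ := [isSub for @fset_val E M].
HB.instance Definition _ := [Choice of P by <:].
HB.instance Definition _ := [Countable of P by <:].
HB.instance Definition _ := [Finite of P by <:].

Lemma feasible0 : set0 \in feasible M.
Proof. by case: (antimatroidP M). Qed.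

Lemma feasibleU (A B : {set E}) :
  A \in feasible M -> B \in feasible M -> A :|: B \in feasible M.
Proof.
move=> + FB; have [n] := ubnP #|B :\: A|; elim: n A => // n IHn A leBn FA.
have [sBA | nsBA] := boolP (B \subset A); first by rewrite (setUidPl sBA).
have [_ _ /(_ A B FA FB nsBA)[x xBA FxA]] := antimatroidP M.
have xB : x \in B by case/setDP: xBA.
have -> : A :|: B = (x |: A) :|: B.
  by rewrite -setUA [RHS](setUidPr _) // sub1set inE xB orbT.
apply: IHn FxA; rewrite -ltnS; apply: leq_trans leBn; rewrite ltnS.
apply: proper_card; rewrite properE setDS ?subsetUr //=.
by apply/subsetPn; exists x => //; rewrite !inE eqxx.
Qed.

Definition fbot : P := FeasibleSet feasible0.

Definition fjoin (X Y : P) : P :=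
  FeasibleSet (feasibleU (fset_valP X) (fset_valP Y)).

Lemma bigcup_feasible (p : pred {set E}) :
  \bigcup_(C in feasible M | p C) C \in feasible M.
Proof.
by elim/big_ind: _ => [|A B|C /andP[]]; [exact: feasible0|exact: feasibleU|].
Qed.

Definition ftop : P := FeasibleSet (bigcup_feasible predT).

(* A :&: B need not be feasible: the meet is the largest feasible subset. *)
Definition fmeet (X Y : P) : P :=
  FeasibleSet (bigcup_feasible (fun C => C \subset X :&: Y)).

Definition fle (X Y : P) : bool := X \subset Y.

Fact fle_refl : reflexive fle. Proof. by move=> X; apply: subxx. Qed.

Fact fle_anti : antisymmetric fle.
Proof. by move=> X Y sXY; apply: val_inj; apply/eqP; rewrite eqEsubset. Qed.

Fact fle_trans : transitive fle.
Proof. by move=> Y X Z; apply: subset_trans. Qed.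

HB.instance Definition _ :=
  Order.Le_isPOrder.Build feasible_display P fle_refl fle_anti fle_trans.

Fact fmeetP (X Y Z : P) : fle X (fmeet Y Z) = fle X Y && fle X Z.
Proof.
rewrite /fle -subsetI; apply/idP/idP => [sX | sX].
  by apply: (subset_trans sX); apply/bigcupsP => C /andP[].
by apply: (bigcup_sup (fset_val X)); rewrite ?fset_valP.
Qed.

Fact fjoinP (X Y Z : P) : fle (fjoin X Y) Z = fle X Z && fle Y Z.
Proof. by rewrite /fle subUset. Qed.

HB.instance Definition _ :=
  Order.POrder_MeetJoin_isLattice.Build feasible_display P fmeetP fjoinP.

Fact fle_bot (X : P) : fle fbot X. Proof. exact: sub0set. Qed.

Fact fle_top (X : P) : fle X ftop.
Proof. by apply: (bigcup_sup (fset_val X)); rewrite ?fset_valP. Qed.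

HB.instance Definition _ :=
  Order.hasBottom.Build feasible_display P fle_bot.
HB.instance Definition _ :=
  Order.hasTop.Build feasible_display P fle_top.

End FeasibleLattice.

Local Open Scope order_scope.

Section Posets.
Variables (d : Order.disp_t) (P : finPOrderType d).
Implicit Types (x y : P) (A c : {set P}).

Definition chain c : bool := [forall x in c, forall y in c, x >=< y].

Definition maximal_chain_in A c : bool :=
  maxset [pred c' | chain c' && (c' \subset A)] c.

Definition maximal_chain c : bool := maximal_chain_in [set: P] c.

Definition interval x y : {set P} := [set z | x <= z <= y].

Definition covers x y : bool := (x < y) && [forall z, ~~ (x < z < y)].

Definition edge := {xy : P * P | covers xy.1 xy.2}.

(* Read from bottom to top. When c is a maximal chain of an interval,
   consecutive elements form covers, so insub discards nothing. *)
Definition chain_edges c : seq edge :=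
  let s := sort <=%O (enum c) in pmap insub (zip s (behead s)).

Definition chain_labels (L : Type) (lab : edge -> L) c : seq L :=
  map lab (chain_edges c).

End Posets.

Definition increasing (L : eqType) (le : rel L) : pred (seq L) :=
  sorted [rel a b | (a != b) && le a b].

(* The sequence s lists the fixed set of labels, so n is size s. *)
Definition Sn_EL_labelling d (P : finTBPOrderType d) (L : eqType)
    (le : rel L) (lab : edge P -> L) : Prop :=
  (exists2 s : seq L, uniq s &
     forall c : {set P}, maximal_chain c -> perm_eq (chain_labels lab c) s) /\
  (forall x y : P, x <= y ->
     exists! c : {set P},
       maximal_chain_in (interval x y) c /\ increasing le (chain_labels lab c)).

Section Lattices.
Variables (d : Order.disp_t) (P : finLatticeType d).
Implicit Types (S m c : {set P}).

Definition sublattice S : bool :=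
  [forall x in S, forall y in S, (x `&` y \in S) && (x `|` y \in S)].

Definition generated_sublattice S : {set P} :=
  \bigcap_(T : {set P} | sublattice T && (S \subset T)) T.

Definition distributive_on S : Prop :=
  {in S & &, forall x y z, x `&` (y `|` z) = (x `&` y) `|` (x `&` z)}.

Definition M_chain m : Prop :=
  maximal_chain m /\
  forall c, maximal_chain c -> distributive_on (generated_sublattice (m :|: c)).

Definition supersolvable_lattice : Prop := exists m, M_chain m.

End Lattices.

Section NaturalLabelling.
Variables (E : finType) (M : antimatroid E).
Local Notation P := (feasible_set M).

Lemma edge_diff (e : edge P) :
  exists x, ((val e).2 : {set E}) :\: ((val e).1 : {set E}) == [set x].
Proof.
case: e => [[X Y] /= /andP[ltXY /forallP noZ]].
have nsYX : ~~ ((Y : {set E}) \subset X) by move: ltXY; rewrite lt_leAnge => /andP[].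
have sXY : (X : {set E}) \subset Y by move/ltW: ltXY.
have [_ _ exM] := antimatroidP M.
have [x /setDP[xY xX] FxX] := exM _ _ (fset_valP X) (fset_valP Y) nsYX.
pose Z := FeasibleSet FxX.
have ltXZ : X < Z.
  rewrite lt_leAnge; apply/andP; split; first exact: subsetUr.
  by apply/subsetPn; exists x; rewrite // !inE eqxx.
have leZY : Z <= Y by apply/subUsetP; rewrite sub1set.
have eqZY : Z = Y.
  by move: (noZ Z); rewrite ltXZ /= lt_neqAle leZY andbT negbK => /eqP.
exists x; apply/eqP/setP => y; rewrite -eqZY !inE.
by case: eqVneq => [->|_]; rewrite ?xX //= andNb.
Qed.

Definition natural_labelling (e : edge P) : E := xchoose (edge_diff e).

Lemma natural_labellingP (e : edge P) :
  ((val e).2 : {set E}) :\: ((val e).1 : {set E}) = [set natural_labelling e].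
Proof. exact/eqP/(xchooseP (edge_diff e)). Qed.

End NaturalLabelling.

(* Main.v *)
Require Import Defs.
From mathcomp Require Import all_boot all_order.

(* For a supersolvable order, A :&: D is feasible whenever A is feasible and D
   is down-closed, so the initial segments I of E form a maximal chain on which
   meets are intersections. Hence the sublattice generated by this chain and a
   maximal chain c consists of unions of sets C :&: I with C in c, a distributive
   lattice of sets. Conversely, order E along an M-chain m. The modular law for
   the members of m shows, by induction on A, that A :&: I is feasible for I in
   m; taking I to be the initial segment ending at x = min (B :\: A), the set
   x |: A = (B :&: I) :|: A is feasible. For the labelling, a maximal chain of
   [X, Y] has increasing labels iff all its members are X together with an
   initial segment of Y :\: X, and such sets form a maximal chain when the
   order is supersolvable; conversely, the first step above A of the increasing
   chain of [A, A :|: B] adds min (B :\: A). *)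

Set Implicit Arguments.
Unset Strict Implicit.
Unset Printing Implicit Defensive.

Import Order.TTheory.
Local Open Scope order_scope.

(** * Maximal chains of intervals in a finite poset *)

Section MaximalChains.
Variables (d : Order.disp_t) (P : finPOrderType d).
Implicit Types (x y z : P) (c A : {set P}).

Lemma chain_comparable c x y : chain c -> x \in c -> y \in c -> x >=< y.
Proof. by move=> /forall_inP cc xc yc; apply: (forall_inP (cc x xc)). Qed.

Lemma chainU1 c z : chain c -> {in c, forall w, z >=< w} -> chain (z |: c).
Proof.
move=> cc zc; apply/forall_inP => x xzc; apply/forall_inP => y yzc.
case/setU1P: xzc => [->|xc]; case/setU1P: yzc => [->|yc].
- exact: comparablexx.
- exact: zc.
- by rewrite comparable_sym zc.
- exact: chain_comparable cc _ _.
Qed.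

Lemma maximal_chain_in_mem A c z :
  maximal_chain_in A c -> z \in A -> {in c, forall w, z >=< w} -> z \in c.
Proof.
move=> /maxsetP[/= /andP[cc sA] maxc] zA zc.
by rewrite -(maxc (z |: c)) ?setU11 ?subsetUr //= chainU1 // subUset sub1set zA.
Qed.

Lemma mem_maximal_chain_in A c z :
  maximal_chain_in A c -> z \in c -> z \in A.
Proof. by move=> /maxsetP[/= /andP[_ /subsetP sA] _]; apply: sA. Qed.

Lemma maximal_chain_in_chain A c : maximal_chain_in A c -> chain c.
Proof. by case/maxsetP => /= /andP[]. Qed.

Lemma maximal_chain_in_sub A c c' :
  maximal_chain_in A c -> maximal_chain_in A c' -> c \subset c' -> c = c'.
Proof. by move=> /maxsetP[_ maxc] /maxsetP[/= c'A _] /maxc ->. Qed.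

Lemma interval_chain_ends x y c : x <= y ->
  maximal_chain_in (interval x y) c -> x \in c /\ y \in c.
Proof.
move=> lexy mc.
have between w : w \in c -> x <= w <= y.
  by move=> /(mem_maximal_chain_in mc); rewrite inE.
by split; apply: (maximal_chain_in_mem mc); rewrite ?inE ?lexx ?lexy //;
  move=> w /between/andP[lexw lewy]; [exact: le_comparable|exact: ge_comparable].
Qed.

(** Turns a chain given as a set into a path of covers, on which labels can be studied by
    induction. *)
Lemma sort_interval_chain x y c : x <= y ->
  maximal_chain_in (interval x y) c ->
  exists s, [/\ sort <=%O (enum c) = x :: s, path (@covers d P) x s
              & last x s = y].
Proof.
move=> lexy mc; have [xc yc] := interval_chain_ends lexy mc.
have between w : w \in c -> x <= w <= y.
  by move=> /(mem_maximal_chain_in mc); rewrite inE.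
have cc := maximal_chain_in_chain mc.
have memS w : (w \in sort <=%O (enum c)) = (w \in c).
  by rewrite mem_sort mem_enum.
have : sorted <%O (sort <=%O (enum c)).
  rewrite lt_sorted_uniq_le sort_uniq enum_uniq.
  apply: (@sort_sorted_in _ (mem c)); last by apply/allP => w; rewrite mem_enum.
  by move=> a b ac bc; apply: chain_comparable cc _ _.
case: (sort _ _) memS => [memS|h s memS sS]; first by have := memS x; rewrite xc.
have eqhx : h = x.
  have /between/andP[lexh _] : h \in c by rewrite -memS mem_head.
  apply/le_anti; rewrite lexh andbT.
  have := xc; rewrite -memS inE => /predU1P[->//|xs].
  by apply: ltW; apply: (allP (lt_path_min sS)).
rewrite {}eqhx in memS sS *; exists s; split=> //.
- have monoS i j : (i <= size s)%N -> (j <= size s)%N ->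
      (nth x (x :: s) i <= nth x (x :: s) j) = (i <= j)%N.
    by move=> lti ltj; apply: lt_sorted_leq_nth sS _ _ _ _.
  have nthS i : (i <= size s)%N -> nth x (x :: s) i \in c.
    by move=> lti; rewrite -memS mem_nth.
  apply/(pathP x) => i lti; set a := nth x (x :: s) i; set b := nth x s i.
  have ltab : a < b.
    by rewrite lt_leAnge (monoS i i.+1) ?(monoS i.+1 i) ?ltnn //= ltnW.
  rewrite /covers ltab /=; apply/forallP => z; apply/negP => /andP[ltaz ltzb].
  (* A member of [c] sits at position at most i or at least [i.+1]. Hence a [z] strictly between [a]
     and [b] is comparable to all of [c], so it belongs to [c], against this same dichotomy. *)
  have cmpz w : w \in c -> (w <= a) || (b <= w).
    rewrite -memS => ws; rewrite -(nth_index x ws).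
    have := ws; rewrite -index_mem ltnS; set j := index w _ => ltj.
    by rewrite (monoS j i) ?(ltnW lti) // (monoS i.+1 j) // leqNgt orNb.
  have : z \in c.
    apply: (maximal_chain_in_mem mc).
      rewrite inE; have /between/andP[lexa _] : a \in c by apply: nthS; apply: ltnW.
      have /between/andP[_ leby] : b \in c by apply: (nthS i.+1).
      by rewrite (le_trans lexa (ltW ltaz)) (le_trans (ltW ltzb) leby).
    move=> w /cmpz/orP[lewa|lebw].
      by apply: ge_comparable; apply: le_trans lewa (ltW ltaz).
    by apply: le_comparable; apply: le_trans (ltW ltzb) lebw.
  by move=> /cmpz; rewrite (lt_geF ltaz) (lt_geF ltzb).
- have /between/andP[_ lely] : last x s \in c by rewrite -memS mem_last.
  apply/le_anti; rewrite lely /=.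
  have := yc; rewrite -memS => ys.
  case/splitPl: ys sS {lely memS} => s1 s2 <-.
  rewrite /= cat_path last_cat => /andP[_]; case/lastP: s2 => //= s2 z.
  move=> /lt_path_min/allP/(_ z).
  by rewrite last_rcons mem_rcons mem_head => /(_ isT)/ltW.
Qed.

End MaximalChains.

(** * Labels along chains of feasible sets *)

Section Antimatroid.
Variables (E : finType) (M : antimatroid E).
Local Notation P := (feasible_set M).
Local Notation lab := (@natural_labelling E M).
Implicit Types (X Y Z W : P) (A B D : {set E}) (c : {set P}) (le : rel E).

Lemma le_subset X Y : (X <= Y) = ((X : {set E}) \subset Y).
Proof. by []. Qed.

Lemma meet_subset X Y : ((X `&` Y : P) : {set E}) \subset (X : {set E}) :&: Y.
Proof. by rewrite subsetI -!le_subset leIl leIr. Qed.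

Lemma subset_meet X Y Z :
  (Z : {set E}) \subset (X : {set E}) :&: Y ->
  (Z : {set E}) \subset (X `&` Y : P).
Proof. by rewrite subsetI -!le_subset lexI. Qed.

Lemma joinE X Y : (X `|` Y : P) = X :|: Y :> {set E}.
Proof. by []. Qed.

Lemma maximal_chainE c :
  maximal_chain c = maximal_chain_in (interval (\bot : P) \top) c.
Proof.
by rewrite /maximal_chain (_ : interval _ _ = setT) //; apply/setP=> X;
  rewrite !inE le0x lex1.
Qed.

(** The cover hypothesis makes [insub] succeed, so the first pair of the zip becomes a genuine edge
    and induction along the path can proceed. *)
Lemma chain_labels_cons X Z s :
  covers X Z -> {e : edge P |
    forall L (f : edge P -> L),
      map f (pmap insub (zip (X :: Z :: s) (Z :: s))) =
      f e :: map f (pmap insub (zip (Z :: s) s))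
    & (Z : {set E}) :\: X = [set lab e]}.
Proof.
move=> cXZ; exists (Sub (X, Z) cXZ) => [L f|]; first by rewrite /= insubT.
by rewrite -natural_labellingP SubK.
Qed.

Lemma covers_path_le X s : path (@covers _ P) X s -> {in X :: s, forall Z, X <= Z}.
Proof.
elim: s X => [|Z s IHs] X /=; first by move=> _ Z; rewrite inE => /eqP->.
case/andP=> /andP[ltXZ _] /IHs leZ W; rewrite inE => /predU1P[->//|/leZ].
exact/le_trans/ltW.
Qed.

Lemma mem_path_labels X s : path (@covers _ P) X s ->
  map lab (pmap insub (zip (X :: s) s)) =i (last X s : {set E}) :\: X /\
  uniq (map lab (pmap insub (zip (X :: s) s))).
Proof.
elim: s X => [|Z s IHs] X /=; first by split=> // a; rewrite setDv inE.
case/andP=> cXZ pZs; have [a -> Da] := chain_labels_cons s cXZ.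
have [memZ uZ] := IHs Z pZs.
have sXZ : (X : {set E}) \subset Z by case/andP: cXZ => /ltW.
have sZY : (Z : {set E}) \subset last Z s.
  by apply: (covers_path_le pZs); apply: mem_last.
have : lab a \in (Z : {set E}) :\: X by rewrite Da set11.
case/setDP=> aZ aX; split=> [b|]; last by rewrite /= uZ memZ !inE aZ.
rewrite inE memZ !inE.
have := in_set1 b (lab a); rewrite -Da !inE => <-.
have [bZ|] := boolP (b \in (Z : {set E})).
  by rewrite (subsetP sZY b bZ) orbF.
by move=> bZ; rewrite andbF /= (contra (subsetP sXZ b)).
Qed.

(** By transitivity the labels increase iff each one precedes all later ones. Phrased through the
    members of the path, this no longer mentions the list and transfers to chains given as sets. *)
Lemma increasing_pathP le X s : antisymmetric le -> transitive le ->
  path (@covers _ P) X s ->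
  reflect (forall Z a b, Z \in X :: s -> a \in (Z : {set E}) :\: X ->
             b \in (last X s : {set E}) :\: Z -> le a b)
    (increasing le (map lab (pmap insub (zip (X :: s) s)))).
Proof.
move=> anti_le trans_le; rewrite /increasing; set lt := [rel a b | _].
have trans_lt : transitive lt.
  move=> b a e /= /andP[neab leab] /andP[nebe lebe].
  rewrite (trans_le b) // andbT; apply: contraNneq neab => eae.
  by apply/eqP/anti_le; rewrite leab eae lebe.
elim: s X => [|Z s IHs] X /=.
  by left=> Z a b; rewrite inE => /eqP->; rewrite setDv inE.
case/andP=> cXZ pZs; have [a -> Da] := chain_labels_cons s cXZ.
have [memZ uZ] := mem_path_labels pZs.
have sXZ : (X : {set E}) \subset Z by case/andP: cXZ => /ltW.
have sZW W : W \in Z :: s -> (Z : {set E}) \subset W.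
  exact: covers_path_le pZs W.
have : lab a \in (Z : {set E}) :\: X by rewrite Da set11.
case/setDP=> aZ aX.
rewrite /= (path_sortedE trans_lt); apply: (iffP andP) => [[]|incr].
  move=> /allP lta /(IHs Z pZs) incr W a' b; rewrite inE => /predU1P[->|Ws].
    by rewrite setDv inE.
  move=> /setDP[a'W a'X] bYW.
  (* Either a' is added above [Z], where induction applies, or it is the first label. *)
  have [a'Z|a'Z] := boolP (a' \in (Z : {set E})); last first.
    by apply: incr Ws _ bYW; rewrite inE a'Z.
  have : a' \in (Z : {set E}) :\: X by rewrite inE a'X.
  rewrite Da => /set1P->; suff bYZ : b \in (last Z s : {set E}) :\: Z.
    by have /andP[] := lta b (etrans (memZ b) bYZ).
  move: bYW; rewrite !inE => /andP[bW ->]; rewrite andbT.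
  by apply: contra bW; apply/subsetP/sZW.
split.
  apply/allP => b; rewrite memZ => bYZ.
  rewrite /= (incr Z (lab a) b) ?inE ?eqxx ?orbT ?aX //; last first.
    by case/setDP: bYZ => -> ->.
  by rewrite andbT; apply: contraTneq aZ => ->; case/setDP: bYZ.
apply/(IHs Z pZs) => W a' b Ws /setDP[a'W a'Z] bYW.
apply: incr bYW; first by rewrite inE Ws orbT.
by rewrite inE a'W (contra (subsetP sXZ a')).
Qed.

Lemma chain_labelsE X c s : sort <=%O (enum c) = X :: s ->
  chain_labels lab c = map lab (pmap insub (zip (X :: s) s)).
Proof. by rewrite /chain_labels /chain_edges => ->. Qed.

Lemma increasing_chainP le X Y c : antisymmetric le -> transitive le ->
  X <= Y -> maximal_chain_in (interval X Y) c ->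
  increasing le (chain_labels lab c) <->
  (forall Z a b, Z \in c -> a \in (Z : {set E}) :\: X ->
     b \in (Y : {set E}) :\: Z -> le a b).
Proof.
move=> anti_le trans_le leXY mc.
have [s [Es ps lasts]] := sort_interval_chain leXY mc.
rewrite (chain_labelsE Es) -lasts.
have memS Z : (Z \in X :: s) = (Z \in c) by rewrite -Es mem_sort mem_enum.
apply: (iff_trans (iff_sym (rwP (increasing_pathP anti_le trans_le ps)))).
by split=> incr Z a b;
  have := incr Z a b; rewrite memS.
Qed.

(** Elements of [E] in no feasible set never occur as labels, so the fixed label set is [\top]
    rather than all of [E]. *)
Lemma perm_chain_labels c :
  maximal_chain c -> perm_eq (chain_labels lab c) (enum (\top : P)).
Proof.
rewrite maximal_chainE => mc.
have [s [Es ps lasts]] := sort_interval_chain (le0x _) mc.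
have [mems us] := mem_path_labels ps.
rewrite (chain_labelsE Es) uniq_perm ?enum_uniq // => a.
by rewrite mems lasts mem_enum !inE.
Qed.

Lemma Sn_EL_labelling_supersolvable le :
  antisymmetric le -> transitive le ->
  Sn_EL_labelling le lab -> supersolvable_antimatroid (feasible M) le.
Proof.
move=> anti_le trans_le [_ EL]; split=> [|A B FA FB nsBA x [/setDP[xB xA] minx]].
  exact: feasible0.
pose X : P := FeasibleSet FA; pose Y : P := X `|` FeasibleSet FB.
have leXY : X <= Y by apply: leUl.
have [c [[mc incr] _]] := EL X Y leXY.
have [[|Z s] [Es ps lasts]] := sort_interval_chain leXY mc.
  case/negP: nsBA.
  by rewrite (_ : A = X) // [X in _ \subset fset_val X]lasts subsetUr.
have {incr} := (increasing_chainP anti_le trans_le leXY mc).1 incr => incr.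
have [cXZ pZ] := andP ps.
have [a _ Da] := chain_labels_cons s cXZ.
have Zc : Z \in c by rewrite -mem_enum -(mem_sort <=%O) Es !inE eqxx orbT.
have sXZ : (X : {set E}) \subset Z by case/andP: cXZ => /ltW.
have eqZ : Z = lab a |: A :> {set E} 
  by rewrite -Da -[LHS](setID _ A) -[A]/(X : {set E}) (setIidPr sXZ) setUC.
have aZX : lab a \in (Z : {set E}) :\: X by rewrite Da set11.
have aBA : lab a \in B :\: A.
  have /subsetP/(_ (lab a)) : (Z : {set E}) \subset Y.
    by move: (mem_maximal_chain_in mc Zc); rewrite inE => /andP[].
  by move: aZX; rewrite !inE => /andP[/negbTE-> ->] /= ->.
(* Minimality gives [le x (lab a)]. If [x] differs from the first label, it is added later, so the
   increasing labels give the reverse inequality. *)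
rewrite (_ : x = lab a) -?eqZ ?fset_valP //.
have [//|nexa] := eqVneq x (lab a); apply: anti_le; rewrite minx //=.
by apply: incr Zc aZX _; rewrite eqZ !inE xB (negbTE xA) (negbTE nexa) orbT.
Qed.

(** For [\bot] and [\top] this is the chain of feasible initial segments of [\top], which serves as
    the M-chain. *)
Definition initial_chain le X Y : {set P} :=
  [set Z in interval X Y |
     [forall b in (Z : {set E}) :\: X, forall a in (Y : {set E}) :\: X,
        le a b ==> (a \in (Z : {set E}))]].

Lemma initial_chainP le X Y Z :
  reflect (X <= Z <= Y /\
           forall a b, b \in (Z : {set E}) -> b \notin (X : {set E}) ->
             a \in (Y : {set E}) -> le a b -> a \in (Z : {set E}))
    (Z \in initial_chain le X Y).
Proof.
rewrite 2!inE; apply: (iffP andP) => -[XZY init]; split=> //.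
  move=> a b bZ bX aY leab; have [aX|aX] := boolP (a \in (X : {set E})).
    by case/andP: XZY => /subsetP sXZ _; apply: sXZ.
  move/forall_inP/(_ b): init; rewrite inE bX => /(_ bZ)/forall_inP/(_ a).
  by rewrite inE aX aY leab => /(_ isT).
apply/forall_inP => b /setDP[bZ bX]; apply/forall_inP => a /setDP[aY _].
by apply/implyP; apply: init bZ bX aY.
Qed.

(** * Consequences of a supersolvable order *)

Section Supersolvable.
Variable le : rel E.
Hypotheses (ord_le : total_order le)
  (ss_le : supersolvable_antimatroid (feasible M) le).

Lemma ex_is_min A : A != set0 -> exists x, is_min le A x.
Proof.
case: ord_le => refl_le _ trans_le total_le.
have [n] := ubnP #|A|; elim: n A => // n IHn A ltAn /set0Pn[y yA].
have [A0|/IHn[|x [xA minx]]] := eqVneq (A :\ y) set0.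
- exists y; split=> // z zA; have [->//|nezy] := eqVneq z y.
  by have /setP/(_ z) := A0; rewrite !inE nezy zA.
- by rewrite -ltnS; apply: leq_trans ltAn; rewrite [#|A|](cardsD1 y) yA.
have {xA}xA : x \in A by case/setD1P: xA.
have minA z : z \in A -> z = y \/ le x z.
  move=> zA; have [|nezy] := eqVneq z y; first by left.
  by right; apply: minx; rewrite !inE nezy.
have [lexy|leyx] := orP (total_le x y).
  by exists x; split=> // z /minA[->|].
by exists y; split=> // z /minA[->//|]; apply: trans_le.
Qed.

(* If G is the largest feasible subset of A :&: D, the least element of A
   outside G cannot lie in D, so by down-closure nothing of A :\: G does. *)
Lemma feasible_setI A D : A \in feasible M ->
    {in A &, forall a b, b \in D -> le a b -> a \in D} ->
  A :&: D \in feasible M.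
Proof.
move=> FA downD.
have [G /maxsetP[/= /andP[FG sGAD] maxG] _] :
    {G | maxset [pred G | (G \in feasible M) && (G \subset A :&: D)] G
       & set0 \subset G}.
  by apply: maxset_exists; rewrite /= feasible0 sub0set.
rewrite (_ : A :&: D = G) //; apply/eqP; rewrite eqEsubset sGAD andbT.
have [sGA sGD] := subsetIP sGAD.
apply/subsetP => b /setIP[bA bD]; apply/negPn/negP => bG.
have nsAG : ~~ (A \subset G) by apply/subsetPn; exists b.
have [|x minx] := @ex_is_min (A :\: G); first by rewrite setD_eq0.
have FxG := ss_le.2 G A FG FA nsAG x minx.
case: minx => /setDP[xA xG] minx.
have xD : x \in D by apply: (downD x b) => //; apply: minx; rewrite inE bG.
case/negP: xG; rewrite -(maxG (x |: G)) ?setU11 ?subsetUr //=.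
by rewrite FxG !(subUset, subsetI, sub1set) xA xD sGA sGD.
Qed.

Lemma initial_chain_maximal X Y :
  X <= Y -> maximal_chain_in (interval X Y) (initial_chain le X Y).
Proof.
case: ord_le => refl_le anti_le trans_le total_le leXY.
apply/maxsetP; split=> /=.
  apply/andP; split; last by apply/subsetP => Z; rewrite inE => /andP[].
  apply/forall_inP => Z /initial_chainP[/andP[leXZ leZY] initZ].
  apply/forall_inP => W /initial_chainP[/andP[leXW leWY] initW].
  (* With [b] in [Z] but not in [W], no [a] of [W] outside [X] can lie above [b]; so it lies below
     [b] and is in [Z]. *)
  have [/le_comparable//|/subsetPn[b bZ bW]] := boolP (Z <= W).
  have bX : b \notin (X : {set E}) by apply: contra bW; apply/subsetP.
  apply/ge_comparable/subsetP => a aW.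
  have aY := subsetP leWY a aW; have bY := subsetP leZY b bZ.
  have [aX|aX] := boolP (a \in (X : {set E})); first exact: subsetP leXZ a aX.
  have [leab|leba] := orP (total_le a b); first exact: initZ bZ bX aY leab.
  by rewrite (initW b a) in bW.
move=> c' /andP[cc' sc'] sub; apply/eqP; rewrite eqEsubset sub andbT.
apply/subsetP => Z Zc'; have := subsetP sc' Z Zc'; rewrite inE => XZY.
apply/initial_chainP; split=> // a b bZ bX aY leab.
(* The initial segment ending at [a] is the test set: if it lies in [Z], then so does [a]; if it
   contains [Z], then [le b a] and so [a] equals [b]. *)
have FW : (X : {set E}) :|: (Y : {set E}) :&: [set e | le e a] \in feasible M.
  apply: feasibleU; first exact: fset_valP.
  apply: feasible_setI => [|e f _ _]; first exact: fset_valP.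
  by rewrite !inE => lefa leef; apply: trans_le lefa.
pose W : P := FeasibleSet FW.
have Wc : W \in initial_chain le X Y.
  apply/initial_chainP; split=> [|e f].
    apply/andP; split; first exact: subsetUl.
    by apply/subUsetP; split; [exact: leXY | exact: subsetIl].
  rewrite !inE => /orP[->//|/andP[_ lefa] _ eY leef].
  by rewrite eY (trans_le f) // orbT.
have /orP[/subsetP leZW|/subsetP leWZ] :=
    chain_comparable cc' Zc' (subsetP sub W Wc); last first.
  by apply: leWZ; rewrite !inE aY refl_le orbT.
have := leZW b bZ; rewrite !inE (negbTE bX) => /andP[_ leba].
by rewrite (anti_le a b) ?leab.
Qed.

(** Uniqueness: increasing labels force every member of the chain into [initial_chain], and one
    maximal chain contained in another equals it. *)
Lemma supersolvable_Sn_EL_labelling : Sn_EL_labelling le lab.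
Proof.
case: ord_le => refl_le anti_le trans_le total_le; split.
  by exists (enum (\top : P)); [apply: enum_uniq | apply: perm_chain_labels].
move=> X Y leXY; have mc0 := initial_chain_maximal leXY.
exists (initial_chain le X Y); split=> [|c [mc]].
  split=> //; apply/(increasing_chainP anti_le trans_le leXY mc0) => Z a b.
  move=> /initial_chainP[/andP[leXZ leZY] initZ] /setDP[aZ aX] /setDP[bY bZ].
  have [//|leba] := orP (total_le a b).
  by rewrite (initZ b a) in bZ.
move/(increasing_chainP anti_le trans_le leXY mc) => incr.
apply/esym/(maximal_chain_in_sub mc mc0)/subsetP => Z Zc.
apply/initial_chainP; split=> [|a b bZ bX aY leab].
  by have := mem_maximal_chain_in mc Zc; rewrite inE.
apply/negPn/negP => aZ.
have leba : le b a by apply: incr Zc _ _; rewrite inE ?bX ?aZ.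
by case/negP: aZ; rewrite (anti_le a b) ?leab.
Qed.

Lemma supersolvable_antimatroid_lattice : supersolvable_lattice P.
Proof.
pose m := initial_chain le (\bot : P) \top.
have mm : maximal_chain m by rewrite maximal_chainE initial_chain_maximal ?le0x.
exists m; split=> // c mc.
have topS c' : maximal_chain c' -> (\top : P) \in c'.
  by rewrite maximal_chainE => /(interval_chain_ends (le0x _))[].
(* [T] holds the feasible unions of sets C :&: I, stated pointwise: each x of X has such a set
   around it inside X. *)
pose T := [set X : P | [forall x in (X : {set E}), exists C in c, exists I in m,
  (x \in (C : {set E}) :&: I) && ((C : {set E}) :&: I \subset X)]].
have inT X : reflect (forall x, x \in (X : {set E}) -> exists C I,
      [/\ C \in c, I \in m, x \in (C : {set E}) :&: I
        & (C : {set E}) :&: I \subset X]) (X \in T).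
  rewrite inE; apply: (iffP forall_inP) => TX x /TX.
    by case/exists_inP=> C cC /exists_inP[I mI /andP[]]; exists C, I.
  by case=> C [I [cC mI xCI sCI]]; apply/exists_inP; exists C => //;
    apply/exists_inP; exists I; rewrite ?xCI.
have FCI (C I : P) : I \in m -> (C : {set E}) :&: I \in feasible M.
  move=> /initial_chainP[_ initI]; apply: feasible_setI; first exact: fset_valP.
  move=> a b aC bC bI; apply: initI bI _ _; rewrite ?inE //.
  exact: (subsetP (lex1 C)).
have TI X Y x : X \in T -> Y \in T -> x \in (X : {set E}) -> x \in (Y : {set E}) ->
    exists C I, [/\ C \in c, I \in m, x \in (C : {set E}) :&: I &
      (C : {set E}) :&: I \subset (X : {set E}) :&: Y].
  move=> /inT TX /inT TY /TX[C [I [cC mI /setIP[xC xI] sX]]].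
  move=> /TY[C' [I' [cC' mI' /setIP[xC' xI'] sY]]].
  (* The smaller of two members of a chain is their intersection, so C :&: I and C' :&: I' meet in a
     set of the same form. *)
  have minc (D D' : P) (d : {set P}) : chain d -> D \in d -> D' \in d ->
      exists2 D'' : P, D'' \in d & (D'' : {set E}) = (D : {set E}) :&: D'.
    move=> cd dD dD'; have /orP[] := chain_comparable cd dD dD';
      [move=> /setIidPl->|move=> /setIidPr->].
      by exists D.
    by exists D'.
  have [C'' cC'' eC] := minc _ _ _ (maximal_chain_in_chain mc) cC cC'.
  have [I'' mI'' eI] := minc _ _ _ (maximal_chain_in_chain mm) mI mI'.
  exists C'', I''; split; rewrite // eC eI ?inE ?xC ?xI ?xC' ?xI' //.
  by rewrite setIACA setISS.
(* The sets C :&: I inside X :&: Y are feasible, hence below the meet, and they cover X :&: Y. *)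
have meetT X Y : X \in T -> Y \in T ->
    ((X `&` Y : P) : {set E}) = (X : {set E}) :&: Y.
  move=> TX TY; apply/eqP; rewrite eqEsubset meet_subset /=.
  apply/subsetP => x /setIP[xX xY].
  have [C [I [cC mI xCI sCI]]] := TI _ _ _ TX TY xX xY.
  by apply: (subsetP (@subset_meet _ _ (FeasibleSet (FCI C I mI)) sCI)).
have subT : generated_sublattice (m :|: c) \subset T.
  apply: bigcap_inf; apply/andP; split.
    apply/forall_inP => X TX; apply/forall_inP => Y TY; apply/andP; split.
      apply/inT => x; rewrite meetT // => /setIP[xX xY].
      exact: TI.
    apply/inT => x /setUP[]; [move/(inT _ TX)|move/(inT _ TY)];
      move=> [C [I [cC mI xCI sCI]]]; exists C, I; split=> //;
      by apply: (subset_trans sCI); rewrite ?subsetUl ?subsetUr.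
  (* Taking [\top] as the other factor puts the members of both chains in [T]. *)
  apply/subsetP => X /setUP[mX|cX]; apply/inT => x xX.
    exists \top, X; split; rewrite ?topS ?subsetIr //.
    by rewrite inE xX andbT; apply: (subsetP (lex1 X)).
  exists X, \top; split; rewrite ?topS ?subsetIl //.
  by rewrite inE xX; apply: (subsetP (lex1 X)).
move=> X Y Z /(subsetP subT) TX /(subsetP subT) TY /(subsetP subT) TZ.
have TYZ : (Y `|` Z : P) \in T.
  apply/inT => x /setUP[]; [move/(inT _ TY)|move/(inT _ TZ)];
    move=> [C [I [cC mI xCI sCI]]]; exists C, I; split=> //;
    by apply: (subset_trans sCI); rewrite ?subsetUl ?subsetUr.
apply: val_inj; apply: (etrans (meetT _ _ TX TYZ)).
by rewrite -[RHS]/(fset_val _) !joinE !meetT // setIUr.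
Qed.

End Supersolvable.

(** * From an M-chain to a supersolvable order *)

Section SupersolvableLattice.
Variable m : {set P}.
Hypothesis m_Mchain : M_chain m.
Implicit Type I : P.

(** Extend [X] and [Y] to a maximal chain; distributivity then applies to [X], [I], [Y], and the
    meet of [X] and [Y] is [Y]. *)
Lemma M_chain_modular X Y I : I \in m -> Y <= X ->
  X `&` (I `|` Y) = (X `&` I) `|` Y.
Proof.
move=> mI leYX; case: m_Mchain => mm distr.
have [c mc sXYc] : {c | maximal_chain c & [set X; Y] \subset c}.
  apply: maxset_exists; rewrite /= subsetT andbT.
  apply: chainU1 => [|w /set1P->]; last exact: ge_comparable.
  apply/forall_inP => a /set1P->; apply/forall_inP => b /set1P->.
  exact: comparablexx.
have sub (Z : P) : Z \in m :|: c -> Z \in generated_sublattice (m :|: c).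
  by apply/subsetP/bigcapsP => T /andP[].
have [Xc Yc] : X \in c /\ Y \in c.
  by split; apply: (subsetP sXYc); rewrite !inE eqxx ?orbT.
by rewrite (distr c mc) ?sub ?inE ?mI ?Xc ?Yc ?orbT // (meet_r leYX).
Qed.

(** Remove [a] from [A] by accessibility. If [a] is in [I], then [X] lies below the join of [I] and
    [Y], and modularity puts [a] in the meet of [X] and [I]. That meet also contains the rest of A
    :&: I by induction, so it equals A :&: I. *)
Lemma M_chain_feasible_setI A I :
  A \in feasible M -> I \in m -> A :&: I \in feasible M.
Proof.
move=> + mI; have [n] := ubnP #|A|; elim: n A => // n IHn A ltAn FA.
have [->|A0] := eqVneq A set0; first by rewrite set0I feasible0.
have [_ acc _] := antimatroidP M.
have [a aA FAa] := acc A FA A0.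
have FAaI : (A :\ a) :&: I \in feasible M.
  apply: IHn FAa; rewrite -ltnS; apply: leq_trans ltAn.
  by rewrite [#|A|](cardsD1 a) aA.
have [aI|aI] := boolP (a \in (I : {set E})); last first.
  rewrite (_ : A :&: I = (A :\ a) :&: I) //; apply/setP => b; rewrite !inE.
  by case: eqVneq => // ->; rewrite (negbTE aI) andbF.
pose X : P := FeasibleSet FA; pose Y : P := FeasibleSet FAa.
have leYX : Y <= X by apply: subD1set.
have leXIY : X <= I `|` Y.
  apply/subsetP => b bA; rewrite joinE !inE.
  by have [->|] := eqVneq; rewrite ?aI // orbC bA.
have := M_chain_modular mI leYX; rewrite (meet_l leXIY) => eqX.
have aXI : a \in (X `&` I : {set E}).
  have : a \in ((X `&` I) `|` Y : {set E}) by rewrite -eqX.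
  by rewrite joinE => /setUP[//|]; rewrite /= !inE eqxx.
rewrite (_ : A :&: I = (X `&` I : P)) ?fset_valP //; apply/eqP.
rewrite eqEsubset meet_subset andbT; apply/subsetP => b /setIP[bA bI].
have [->//|neba] := eqVneq b a.
apply: (subsetP (@subset_meet _ _ (FeasibleSet FAaI) _)) => /=.
  by rewrite setSI // subD1set.
by rewrite !inE neba bA.
Qed.

(* enum_rank breaks ties between elements outside \top, which lie in no member
   of m. *)
Definition M_chain_rank (x : E) : nat :=
  #|[set I in m | x \notin (I : {set E})]| * #|E| + enum_rank x.

Definition M_chain_order : rel E := relpre M_chain_rank leq.

(** Since [enum_rank] stays below [#|E|], the number of members of [m] avoiding an element is the
    leading digit of its rank in base [#|E|]. *)
Lemma M_chain_rank_lt x y :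
  (#|[set I in m | x \notin (I : {set E})]| <
     #|[set I in m | y \notin (I : {set E})]|)%N ->
  (M_chain_rank x < M_chain_rank y)%N.
Proof.
move=> lt_xy; apply: leq_trans (leq_addr _ _).
apply: leq_trans (leq_mul lt_xy (leqnn _)).
by rewrite /M_chain_rank mulSn addnC ltn_add2r.
Qed.

Lemma M_chain_order_total : total_order M_chain_order.
Proof.
rewrite /M_chain_order; split=> [x|x y|y x z|x y] /=.
- exact: leqnn.
- rewrite -eqn_leq => /eqP eq_xy.
  have eq_mod z : M_chain_rank z = enum_rank z %[mod #|E|].
    by rewrite /M_chain_rank modnMDl.
  have := eq_mod x; rewrite eq_xy eq_mod !modn_small // => /val_inj.
  by move/enum_rank_inj.
- exact: leq_trans.
- exact: leq_total.
Qed.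

(* J, the largest member of m avoiding x, is covered in m by x |: J. *)
Lemma M_chain_initial x : x \in ((\top : P) : {set E}) ->
  exists2 I, I \in m &
    x \in (I : {set E}) /\ {in (I : {set E}), forall y, M_chain_order y x}.
Proof.
move=> xtop; have [mm _] := m_Mchain.
have cm := maximal_chain_in_chain mm.
have [botm topm] : (\bot : P) \in m /\ (\top : P) \in m.
  by apply: interval_chain_ends (le0x _) _; rewrite -maximal_chainE.
have botP : (\bot \in m) && (x \notin ((\bot : P) : {set E})) by rewrite botm inE.
have topP : (\top \in m) && (x \in ((\top : P) : {set E})) by rewrite topm.
case: (@arg_maxnP P \bot [pred I : P | (I \in m) && (x \notin (I : {set E}))]
         (fun I => #|(I : {set E})|) botP) => J /andP[mJ xJ] maxJ.
have ltJ I : I \in m -> x \notin (I : {set E}) -> (I : {set E}) \subset J.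
  move=> mI xI; have /orP[//|leJI] := chain_comparable cm mI mJ.
  have := maxJ I; rewrite /= mI xI => /(_ isT) leIJ.
  by have /eqP-> : (J : {set E}) == I by rewrite eqEcard -le_subset leJI.
case: (@arg_minnP P \top [pred I : P | (I \in m) && (x \in (I : {set E}))]
         (fun I => #|(I : {set E})|) topP) => K /andP[mK xK] minK.
have ltK I : I \in m -> x \in (I : {set E}) -> (K : {set E}) \subset I.
  move=> mI xI; have /orP[//|leIK] := chain_comparable cm mK mI.
  have := minK I; rewrite /= mI xI => /(_ isT) leKI.
  by have /eqP<- : (I : {set E}) == K by rewrite eqEcard -le_subset leIK.
have nsKJ : ~~ ((K : {set E}) \subset J) by apply/subsetPn; exists x.
have sJK : (J : {set E}) \subset K.
  by have /orP[|/(negP nsKJ)] := chain_comparable cm mJ mK.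
have [_ _ exM] := antimatroidP M.
have [z /setDP[zK zJ] FzJ] := exM _ _ (fset_valP J) (fset_valP K) nsKJ.
pose I : P := FeasibleSet FzJ.
(* Members of [m] containing [x] contain [K], the others lie in [J]; so [I], between [J] and [K], is
   comparable to all of them. *)
have mI : I \in m.
  apply: (maximal_chain_in_mem mm); first by rewrite inE.
  move=> W mW; have [xW|xW] := boolP (x \in (W : {set E})).
    apply/le_comparable/(subset_trans _ (ltK W mW xW)).
    by rewrite subUset sub1set zK.
  exact/ge_comparable/(subset_trans (ltJ W mW xW))/subsetUr.
have xI : x \in (I : {set E}).
  apply/negPn/negP => /(ltJ I mI)/subsetP/(_ z).
  by rewrite setU11 (negbTE zJ) => /(_ isT).
have eqxz : x = z by move: xI; rewrite !inE (negbTE xJ) orbF => /eqP.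
exists I => //; split=> // y; rewrite !inE -eqxz => /predU1P[->|yJ].
  exact: leqnn.
(* Members avoiding [y] avoid [x] too, as those containing [x] contain [J]; and [J] avoids only [x],
   which makes the inclusion strict. *)
apply/ltnW/M_chain_rank_lt/proper_card/properP; split.
  apply/subsetP => W; rewrite !inE => /andP[mW yW]; rewrite mW.
  apply: contra yW => xW; apply: (subsetP (ltK W mW xW)).
  exact: (subsetP sJK).
by exists J; rewrite inE mJ ?xJ // yJ.
Qed.

Lemma M_chain_supersolvable_antimatroid :
  supersolvable_antimatroid (feasible M) M_chain_order.
Proof.
split=> [|A B FA FB nsBA x [/setDP[xB xA] minx]]; first exact: feasible0.
have [_ anti_le _ _] := M_chain_order_total.
have [|I mI [xI maxI]] := @M_chain_initial x.
  exact: (subsetP (lex1 (FeasibleSet FB : P))).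
rewrite (_ : x |: A = B :&: I :|: A); last first.
  apply/setP => y; rewrite !inE; have [->|neyx] /= := eqVneq y x.
    by rewrite xB xI.
  have [|yA] := boolP (y \in A); rewrite ?orbT ?orbF //.
  (* Such a [y] is at most [x] because it is in [I], and at least [x] because it is in B :\: A. *)
  apply/esym/negbTE/negP => /andP[yB yI]; case/eqP: neyx.
  by apply: anti_le; rewrite maxI // minx // inE yA.
by rewrite feasibleU // M_chain_feasible_setI.
Qed.

End SupersolvableLattice.

End Antimatroid.

Theorem theorem2p13 (E : finType) (M : antimatroid E) :
  [<-> exists leE : rel E,
         total_order leE /\ supersolvable_antimatroid (feasible M) leE;
       supersolvable_lattice (feasible_set M);
       exists leE : rel E,
         total_order leE /\
         Sn_EL_labelling leE (@natural_labelling E M)].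
Proof.
tfae.
- by case=> le [ord_le ss_le]; apply: supersolvable_antimatroid_lattice ss_le.
(* This implication passes through the supersolvable order built from the M-chain. *)
- case=> m m_Mchain; exists (M_chain_order m).
  split; first exact: M_chain_order_total.
  apply: supersolvable_Sn_EL_labelling; first exact: M_chain_order_total.
  exact: M_chain_supersolvable_antimatroid.
- case=> le [ord_le EL]; exists le; split=> //.
  have [_ anti_le trans_le _] := ord_le.
  exact: Sn_EL_labelling_supersolvable EL.
Qed.
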